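(* Let $P_1=EENN$ and $P_6=NNEE$, and for $k\in\{1,6\}$ let $$F_k(x,t)=1+\sum_{n\ge 1}t^n\sum_{L\in\mathcal{L}_n}x^{P_k\text{-mch}(L)}.$$ Then $$F_1(x,t)=F_6(x,t)=\frac{C(t)-1}{t\left(1-(C(xt)-1)(C(t)-1)\right)}=\frac{2x}{x\sqrt{1-4t}+\sqrt{1-4xt}+x-1},$$ where $C(z)=\frac{1-\sqrt{1-4z}}{2z}$ is the ordinary generating function of the Catalan numbers.
   Context: $\mathcal{L}_n$ is the set of lattice paths from $(0,0)$ to $(n,n)$ consisting of unit north steps $N$ and unit east steps $E$, equivalently words with $n$ letters $E$ and $n$ letters $N$. For $L\in\mathcal{L}_n$ and $A\subseteq\{1,\dots,n\}$, $ps_L(A)$ is the word obtained from $L$ by deleting, for every $i\in\{1,\dots,n\}\setminus A$, the $i$-th occurrence of $E$ and the $i$-th occurrence of $N$ (reading from left to right). For $P\in\mathcal{L}_2$, $P\text{-mch}(L)$ is the number of $j\in\{1,\dots,n-1\}$ with $ps_L(\{j,j+1\})=P$. Identities are between formal power series in $t$ with coefficients polynomial in $x$ (quotients taken in the fraction field); $\sqrt{1-4z}$ denotes the formal power series square root with constant term $1$. *)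

(* Defs.v *)
From HB Require Import structures.
From mathcomp Require Import all_boot all_order all_algebra.
From mathcomp Require Import boolp classical_sets.

Set Implicit Arguments.
Unset Strict Implicit.
Unset Printing Implicit Defensive.

Import GRing.Theory.
Local Open Scope ring_scope.

Notation "x %:F" := (@FracField.tofrac _ x) : ring_scope.

(* R[[t]]: a series is its coefficient sequence.  Equality, choice and inverses
   on it are classical.  The wrapper keeps the
   Cauchy product apart from the pointwise ring structure on functions. *)
Record fps (R : Type) := FPS { fps_coef :> nat -> R }.

HB.instance Definition _ (R : Type) := gen_eqMixin (fps R).
HB.instance Definition _ (R : Type) := gen_choiceMixin (fps R).

Lemma fpsP (R : Type) (f g : fps R) : f =1 g -> f = g.
Proof. by case: f g => [f] [g] /= fg; congr FPS; apply/funext. Qed.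

Section ComRing.
Variable R : comNzRingType.
Implicit Types f g h : fps R.

Definition fps_zero : fps R := FPS (fun _ => 0).
Definition fps_opp f : fps R := FPS (fun n => - f n).
Definition fps_add f g : fps R := FPS (fun n => f n + g n).
Definition fpsC (c : R) : fps R := FPS (fun n => if n == 0%N then c else 0).
Definition fps_mul f g : fps R := FPS (fun n => \sum_(i < n.+1) f i * g (n - i)%N).

Fact fps_addA : associative fps_add.
Proof. by move=> f g h; apply/fpsP => n /=; rewrite addrA. Qed.
Fact fps_addC : commutative fps_add.
Proof. by move=> f g; apply/fpsP => n /=; rewrite addrC. Qed.
Fact fps_add0 : left_id fps_zero fps_add.
Proof. by move=> f; apply/fpsP => n /=; rewrite add0r. Qed.
Fact fps_addN : left_inverse fps_zero fps_opp fps_add.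
Proof. by move=> f; apply/fpsP => n /=; rewrite addNr. Qed.

HB.instance Definition _ :=
  GRing.isZmodule.Build (fps R) fps_addA fps_addC fps_add0 fps_addN.

(* Truncation to {poly R}, used to transfer the ring axioms. *)
Definition fps_trunc (m : nat) f : {poly R} := \poly_(i < m) f i.

Lemma fps_mul_trunc f g n m : (n < m)%N ->
  fps_mul f g n = (fps_trunc m f * fps_trunc m g)`_n.
Proof.
move=> nm; rewrite coefM /=; apply: eq_bigr => i _.
by rewrite !coef_poly (leq_ltn_trans (leq_ord i) nm)
  (leq_ltn_trans (leq_subr i n) nm).
Qed.

Lemma fps_mul_truncl f (p : {poly R}) g n m : (n < m)%N ->
  (forall i, (i <= n)%N -> f i = p`_i) ->
  fps_mul f g n = (p * fps_trunc m g)`_n.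
Proof.
move=> nm fp; rewrite coefM /=; apply: eq_bigr => i _.
by rewrite fp ?leq_ord// coef_poly (leq_ltn_trans (leq_subr i n) nm).
Qed.

Fact fps_mulC : commutative fps_mul.
Proof.
by move=> f g; apply/fpsP => n; rewrite !(fps_mul_trunc _ _ (ltnSn n)) mulrC.
Qed.

Fact fps_mulA : associative fps_mul.
Proof.
move=> f g h; apply/fpsP => n; rewrite fps_mulC.
rewrite (@fps_mul_truncl _ (fps_trunc n.+1 g * fps_trunc n.+1 h) _ n n.+1)//;
  last by move=> i lin; exact: fps_mul_trunc.
rewrite (@fps_mul_truncl _ (fps_trunc n.+1 f * fps_trunc n.+1 g) _ n n.+1)//;
  last by move=> i lin; exact: fps_mul_trunc.
by rewrite mulrC mulrA.
Qed.

Fact fps_mul1 : left_id (fpsC 1) fps_mul.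
Proof.
move=> f; apply/fpsP => n /=; rewrite big_ord_recl /= mul1r subn0.
by rewrite big1 ?addr0// => i _; rewrite mul0r.
Qed.

Fact fps_mulDl : left_distributive fps_mul fps_add.
Proof.
move=> f g h; apply/fpsP => n /=; rewrite -big_split /=.
by apply: eq_bigr => i _; rewrite mulrDl.
Qed.

Fact fps_one_neq0 : fpsC 1 != 0.
Proof. by apply/eqP => /(congr1 (fun f => f 0%N))/eqP; rewrite /= oner_eq0. Qed.

HB.instance Definition _ := GRing.Zmodule_isComNzRing.Build (fps R)
  fps_mulA fps_mulC fps_mul1 fps_mulDl fps_one_neq0.

Definition fps_unit : {pred fps R} := fun f => `[< exists g, g * f = 1 >].
Definition fps_inv f : fps R := xget f [set g | g * f = 1]%classic.

Fact fps_mulV : {in fps_unit, left_inverse 1 fps_inv *%R}.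
Proof. by move=> f /asboolP[g gf]; rewrite /fps_inv; case: xgetP => [h _|/(_ g)]. Qed.
Fact fps_unitP f g : g * f = 1 -> fps_unit f.
Proof. by move=> gf; apply/asboolP; exists g. Qed.
Fact fps_inv_out : {in [predC fps_unit], fps_inv =1 id}.
Proof.
move=> f /negP nf; rewrite /fps_inv; case: xgetP => // g _ gf.
by case: nf; exact: fps_unitP gf.
Qed.

HB.instance Definition _ := GRing.ComNzRing_hasMulInverse.Build (fps R)
  fps_mulV fps_unitP fps_inv_out.

Lemma fps0E n : (0 : fps R) n = 0. Proof. by []. Qed.
Lemma fps1E n : (1 : fps R) n = if n == 0%N then 1 else 0. Proof. by []. Qed.
Lemma fpsNE f n : (- f) n = - f n. Proof. by []. Qed.
Lemma fpsDE f g n : (f + g) n = f n + g n. Proof. by []. Qed.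
Lemma fpsME f g n : (f * g) n = \sum_(i < n.+1) f i * g (n - i)%N.
Proof. by []. Qed.

Definition fpsX : fps R := FPS (fun n => if n == 1%N then 1 else 0).

Definition fps_sqrt f : fps R := xget 0 [set g | g ^+ 2 = f /\ g 0%N = 1]%classic.

End ComRing.

Section IntegralDomain.
Variable R : idomainType.

Fact fps_idomain : GRing.integral_domain_axiom (fps R).
Proof.
move=> f g fg0; apply/orP; case: (boolP (f == 0)) => [|f0]; [by left|right].
case: (boolP (g == 0)) => // g0; exfalso.
have nz (h : fps R) : h != 0 -> exists n, h n != 0.
  move=> h0; apply: contrapT => nh; move/eqP: h0; apply; apply/fpsP => n.
  by apply/eqP; apply: contrapT => hn; apply: nh; exists n; apply/negP.
have [m fm mmin] := ex_minnP (nz f f0); have [n gn nmin] := ex_minnP (nz g g0).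
have /eqP := congr1 (fun h : fps R => h (m + n)%N) fg0; apply/negP.
have lt_mn : (m < (m + n).+1)%N by rewrite ltnS leq_addr.
rewrite fpsME (bigD1 (Ordinal lt_mn)) //= addKn big1 ?addr0 ?mulf_neq0//.
move=> i; rewrite -val_eqE /= neq_ltn => /orP[ltim|ltmi].
  have [->|/mmin] := eqVneq (f i) 0; first by rewrite mul0r.
  by rewrite leqNgt ltim.
have [->|/nmin] := eqVneq (g (m + n - i)%N) 0; first by rewrite mulr0.
by rewrite leqNgt ltn_subLR ?ltn_add2r ?ltmi// -ltnS ltn_ord.
Qed.

HB.instance Definition _ :=
  GRing.ComUnitRing_isIntegral.Build (fps R) fps_idomain.

(* Uniqueness and existence of the square root, so that [fps_sqrt] is the
   intended series and not its default value. *)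
Lemma fps_sqrt_uniq (f g h : fps R) : (2%:R : R) != 0 ->
  g ^+ 2 = f -> g 0%N = 1 -> h ^+ 2 = f -> h 0%N = 1 -> g = h.
Proof.
move=> n2 gf g0 hf h0; apply/eqP; move: (eqf_sqr g h); rewrite gf hf eqxx.
move=> /esym/orP[//|/eqP/(congr1 (fun u : fps R => u 0%N))].
by rewrite fpsNE g0 h0 => /eqP; rewrite -addr_eq0 (negPf n2).
Qed.

(* The first n + 1 coefficients of the square root. *)
Fixpoint sqrt_coefs (f : nat -> R) (n : nat) : seq R :=
  if n is m.+1 then
    let s := sqrt_coefs f m in
    rcons s ((f m.+1 - \sum_(i < m) s`_i.+1 * s`_(m - i)) / 2%:R)
  else [:: 1].

Lemma size_sqrt_coefs f n : size (sqrt_coefs f n) = n.+1.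
Proof. by elim: n => //= n IHn; rewrite size_rcons IHn. Qed.

Lemma nth_sqrt_coefs f n i :
  (i <= n)%N -> (sqrt_coefs f n)`_i = (sqrt_coefs f i)`_i.
Proof.
elim: n => [|n IHn]; first by rewrite leqn0 => /eqP->.
rewrite leq_eqVlt => /orP[/eqP->//|]; rewrite ltnS => lein.
by rewrite /= nth_rcons size_sqrt_coefs ltnS lein IHn.
Qed.

Lemma sqrt_coefsS f m : let g n := (sqrt_coefs f n)`_n in
  g m.+1 = (f m.+1 - \sum_(i < m) g i.+1 * g (m - i)%N) / 2%:R.
Proof.
move=> g; rewrite {1}/g /= nth_rcons size_sqrt_coefs ltnn eqxx.
congr ((_ - _) / _); apply: eq_bigr => i _.
by rewrite (nth_sqrt_coefs f (ltn_ord i)) (nth_sqrt_coefs f (leq_subr i m)).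
Qed.

Lemma fps_sqrtP (f : fps R) : (2%:R : R) \is a GRing.unit -> f 0%N = 1 ->
  fps_sqrt f ^+ 2 = f /\ fps_sqrt f 0%N = 1.
Proof.
move=> u2 f0; rewrite /fps_sqrt; case: xgetP => // noroot.
pose g n := (sqrt_coefs f n)`_n; case: (noroot (FPS g)); split=> //.
rewrite expr2; apply/fpsP => -[|m]; rewrite fpsME.
  by rewrite big_ord1 /g /= mulr1 f0.
have g0 : FPS g 0%N = 1 by [].
rewrite big_ord_recl big_ord_recr subn0 lift0 subnn g0 mul1r mulr1.
rewrite (eq_bigr (fun i : 'I_m => g i.+1 * g (m - i)%N)); last first.
  by move=> i _; rewrite lift0 subSS.
rewrite [FPS g m.+1](sqrt_coefsS f m) -/g.
set S := \sum_(i < m) _; set q := _ / _.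
by rewrite addrCA -mulr2n -(mulr_natr q) divrK// addrC subrK.
Qed.

(* C(z) for a nonzero series z without constant term; the quotient only exists
   a priori in the fraction field. *)
Definition catalan_gf (z : fps R) : {fraction (fps R)} :=
  (1 - fps_sqrt (1 - 4%:R * z))%:F / (2%:R * z)%:F.

End IntegralDomain.

Definition catalan (n : nat) : nat := ('C(n.*2, n) %/ n.+1)%N.

Definition step := bool.
Definition E : step := true.
Definition N : step := false.

Definition lpaths (n : nat) : {set (n + n).-tuple step} :=
  [set L : (n + n).-tuple step |
    (count_mem E L == n) && (count_mem N L == n)].

(* The letter at position p is the [rank L p]-th occurrence, counted from 1, of
   that letter in L. *)
Definition rank (L : seq step) (p : nat) : nat :=
  count_mem (nth E L p) (take p.+1 L).

(* Deleting the i-th E and the i-th N for all i in {1..n} \ A amounts to keeping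
   the letters of rank in A, all ranks lying in {1..n} for L in [lpaths n]. *)
Definition ps (L : seq step) (A : pred nat) : seq step :=
  mask [seq A (rank L p) | p <- iota 0 (size L)] L.

Definition mch (n : nat) (P L : seq step) : nat :=
  count (fun j => ps L (pred2 j j.+1) == P) (index_iota 1 n).

Definition P1 : seq step := [:: E; E; N; N].
Definition P6 : seq step := [:: N; N; E; E].

(* The coefficient ring is Q[x], with x written 'X. *)
Definition F (P : seq step) : fps {poly rat} :=
  1 + FPS (fun n => if n == 0%N then 0
                    else \sum_(L in lpaths n) 'X^(mch n P L)).

(* Main.v *)
Require Import Defs.
From mathcomp Require Import all_boot all_order all_algebra.
From mathcomp Require Import ring zify.

(* Say that a prefix of a path has height #E - #N.  The pattern EENN occurs at j
   iff the j-th N is preceded by more than j letters E, i.e. ends at height >= 1,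
   so F_1 counts balanced words with weight x for each such N.  Put A = C(xt) and
   B = C(t).  Cutting at the returns to height 0, an excursion above the axis
   contributes t A (its last N is not counted) and one below contributes t B,
   whence F_1 = 1 / (1 - t A - t B); the closed forms follow from A = 1 + x t A^2
   and B = 1 + t B^2.  Instead of cutting words, the sums over words with e E's
   and n N's are computed for all e and n at once, by checking that the coefficients
   predicted by first passages satisfy the recurrence on the first letter.
   Exchanging E and N turns F_6 into F_1. *)

Set Implicit Arguments.
Unset Strict Implicit.
Unset Printing Implicit Defensive.

Import GRing.Theory.
Local Open Scope ring_scope.

(** * Coefficients of products, and geometric series in R[[t]] *)

Section Series.
Variable R : comNzRingType.
Implicit Types (f g : fps R) (c : R).
Local Notation t := (fpsX R).

Lemma coef_fpsCM c f n : (fpsC c * f) n = c * f n.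
Proof.
rewrite fpsME big_ord_recl /= subn0 big1 ?addr0// => i _.
by rewrite mul0r.
Qed.

Lemma coef_fpsXM f n : (t * f) n = if n is m.+1 then f m else 0.
Proof.
rewrite fpsME; case: n => [|n]; first by rewrite big_ord1 /= mul0r.
rewrite 2!big_ord_recl /= mul0r add0r mul1r subSS subn0 big1 ?addr0// => i _.
by rewrite mul0r.
Qed.

Lemma coef0_fpsM f g : (f * g) 0%N = f 0%N * g 0%N.
Proof. by rewrite fpsME big_ord1. Qed.

Lemma fpsC1 : fpsC (1 : R) = 1. Proof. by []. Qed.

(** Coefficients of 1 / (1 - t f). Each depends on all the earlier ones, so the recursion carries
    the whole list. *)
Fixpoint geom_coefs f (n : nat) : seq R :=
  if n is m.+1 then
    let s := geom_coefs f m in rcons s (\sum_(i < m.+1) f i * s`_(m - i))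
  else [:: 1].

Lemma size_geom_coefs f n : size (geom_coefs f n) = n.+1.
Proof. by elim: n => //= n IHn; rewrite size_rcons IHn. Qed.

Lemma nth_geom_coefs f n i :
  (i <= n)%N -> (geom_coefs f n)`_i = (geom_coefs f i)`_i.
Proof.
elim: n => [|n IHn]; first by rewrite leqn0 => /eqP->.
rewrite leq_eqVlt => /orP[/eqP->//|]; rewrite ltnS => lein.
by rewrite /= nth_rcons size_geom_coefs ltnS lein IHn.
Qed.

Lemma fps_geom_exists f : exists g, g = 1 + t * (f * g).
Proof.
exists (FPS (fun n => (geom_coefs f n)`_n)); apply/fpsP => -[|n].
  by rewrite fpsDE coef_fpsXM addr0.
rewrite fpsDE coef_fpsXM fps1E add0r fpsME /=.
rewrite nth_rcons size_geom_coefs ltnn eqxx; apply: eq_bigr => i _.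
by rewrite (nth_geom_coefs f (leq_subr i n)).
Qed.

End Series.

(** * Catalan numbers *)

(** The division in [catalan] is exact, with quotient ['C(n.*2, n) - 'C(n.*2, n.+1)]. *)
Lemma catalanE n : (n.+1 * catalan n = 'C(n.*2, n))%N.
Proof.
rewrite mulnC divnK//; apply/dvdnP; exists ('C(n.*2, n) - 'C(n.*2, n.+1))%N.
have := mul_bin_left n.*2 n; rewrite -addnn addnK.
by rewrite mulnBl [('C(_, n.+1) * _)%N]mulnC => ->; lia.
Qed.

Lemma catalanS n : (n.+2 * catalan n.+1 = 2 * (n.*2.+1 * catalan n))%N.
Proof.
have h1 := mul_bin_diag n.*2.+2 n; have h2 := mul_bin_diag n.*2.+1 n.
have hS : 'C(n.*2.+1, n) = 'C(n.*2.+1, n.+1).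
  by rewrite -[RHS]bin_sub; [congr binomial; lia | lia].
move: h1 h2 (catalanE n) (catalanE n.+1); rewrite doubleS /= hS => h1 h2 h3 h4.
apply/eqP; rewrite -(eqn_pmul2l (ltn0Sn n)); apply/eqP.
rewrite h4 -h1.
transitivity (2 * (n.+1 * 'C(n.*2.+1, n.+1)))%N; first by lia.
by rewrite -h2 -h3; lia.
Qed.

(** Pairing i with m - i turns the weight i + 1 into its average (m + 2) / 2, which is [sym]. Under
    this weight [catalanS] reduces the sum for n + 1 to the one for n. *)
Lemma catalan_conv n :
  (\sum_(i < n.+1) catalan i * catalan (n - i) = catalan n.+1)%N.
Proof.
have sym m : (2 * \sum_(i < m.+1) i.+1 * (catalan i * catalan (m - i)) =
              m.+2 * \sum_(i < m.+1) catalan i * catalan (m - i))%N.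
  rewrite mul2n -addnn [X in (X + _)%N](reindex_inj rev_ord_inj) /=.
  rewrite -big_split big_distrr /=; apply: eq_bigr => i _.
  rewrite subSS subKn; last by rewrite -ltnS.
  rewrite [(catalan (m - i) * _)%N]mulnC -mulnDl.
  by congr muln; have := ltn_ord i; lia.
elim: n => [|n IHn]; first by rewrite big_ord1.
apply/eqP; rewrite -(eqn_pmul2l (ltn0Sn n.+2)) -sym catalanS; apply/eqP.
congr muln; rewrite big_ord_recl /= mul1n subn0.
rewrite (eq_bigr (fun i : 'I_n.+1 => 4 * (i.+1 * (catalan i * catalan (n - i)))
   - 2 * (catalan i * catalan (n - i)))%N); last first.
  by move=> i _; rewrite /bump leq0n add1n subSS mulnA catalanS; lia.
rewrite sumnB => [|i _]; last by lia.
rewrite -!big_distrr /= -[4%N]/(2 * 2)%N -mulnA sym IHn.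
rewrite [catalan 0]/catalan /= bin0 divn1 mulnA -mulnBl -mulnDl.
by congr muln; lia.
Qed.

Definition catalan_fps (R : comNzRingType) (c : R) : fps R :=
  FPS (fun n => (catalan n)%:R * c ^+ n).

Lemma catalan_fps0 (R : comNzRingType) (c : R) : catalan_fps c 0%N = 1.
Proof. by rewrite /= /catalan bin0 divn1 mulr1. Qed.

Lemma catalan_fpsE (R : comNzRingType) (c : R) :
  catalan_fps c = 1 + fpsC c * fpsX R * catalan_fps c ^+ 2.
Proof.
apply/fpsP => n; rewrite -mulrA fpsDE coef_fpsCM coef_fpsXM.
case: n => [|n]; first by rewrite catalan_fps0 mulr0 addr0.
rewrite fps1E add0r expr2 fpsME mulr_sumr /= -catalan_conv.
rewrite natr_sum mulr_suml; apply: eq_bigr => i _.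
have le_in : (i <= n)%N by rewrite -ltnS.
by rewrite natrM -[in c ^+ n.+1](subnKC le_in) exprS exprD mulrCA [_ * _ * (_ * _)]mulrACA.
Qed.

(** With K = 1 + z K^2, the square of 1 - 2 z K is 1 - 4 z (K - z K^2) = 1 - 4 z, and a root with
    constant term 1 is unique. *)
Lemma fps_sqrt_catalan (R : idomainType) (c : R) : (2%:R : R) != 0 ->
  fps_sqrt (1 - 4%:R * (fpsC c * fpsX R)) =
  1 - 2%:R * (fpsC c * fpsX R) * catalan_fps c.
Proof.
move=> n2; set z := fpsC c * _; set g := RHS.
have g2 : g ^+ 2 = 1 - 4%:R * z.
  have := catalan_fpsE c; rewrite -/z /g; set K := catalan_fps c => hK.
  transitivity (1 - 4%:R * z * (K - z * K ^+ 2)); first by ring.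
  by rewrite [X in X - z * _]hK; ring.
have g0 : g 0%N = 1.
  by rewrite /g /z fpsDE fpsNE !coef0_fpsM /= !(mulr0, mul0r) subr0.
(* The root [g] rules out the default value of [fps_sqrt]. *)
rewrite /fps_sqrt; case: classical_sets.xgetP => [h _ [h2 h0]|/(_ g)[]//].
exact: fps_sqrt_uniq n2 h2 h0 g2 g0.
Qed.

Lemma catalan_gfE (R : idomainType) (c : R) : (2%:R : R) != 0 -> c != 0 ->
  catalan_gf (fpsC c * fpsX R) = (catalan_fps c)%:F.
Proof.
move=> n2 c0; rewrite /catalan_gf fps_sqrt_catalan//; set z := fpsC c * _.
have z0 : 2%:R * z != 0.
  apply/eqP => /(congr1 (fun f : fps R => f 1%N)).
  rewrite mulr_natl mulr2n fpsDE coef_fpsCM /= mulr1 -mulr2n -mulr_natl => /eqP.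
  by rewrite mulf_eq0 (negPf n2) (negPf c0).
rewrite opprB addrC subrK rmorphM mulrC mulKf//.
by rewrite tofrac_eq0.
Qed.

(** * Words weighted by the number of high N steps *)

(* In a word with as many E's as N's, comparing the numbers of remaining letters
   amounts to comparing the numbers of letters already read. *)
Fixpoint high_N (L : seq step) : nat :=
  if L is c :: L' then
    ((c == N) && (count_mem E L' < count_mem N L') + high_N L')%N
  else 0.

(* The part of [ps] coming from L, when a letters E and b letters N precede L. *)
Fixpoint ps_from (a b : nat) (A : pred nat) (L : seq step) : seq step :=
  if L is c :: L' then
    if c then (if A a.+1 then [:: E] else [::]) ++ ps_from a.+1 b A L'
    else (if A b.+1 then [:: N] else [::]) ++ ps_from a b.+1 A L'
  else [::].

(** Ranks refer to the whole word, so the induction on [L] needs an arbitrary prefix [u], of which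
    only the letter counts matter. *)
Lemma ps_from_rank (A : pred nat) u L :
  mask [seq A (rank (u ++ L) p) | p <- iota (size u) (size L)] L =
  ps_from (count_mem E u) (count_mem N u) A L.
Proof.
elim: L u => [|c L IHL] u //.
rewrite [size (_ :: _)]/= [iota _ _]/= [map _ _]/= mask_cons.
have -> : rank (u ++ c :: L) (size u) = (count_mem c u).+1.
  rewrite /rank nth_cat ltnn subnn /= -cat_rcons -(size_rcons u c).
  by rewrite take_size_cat// -cats1 count_cat /= eqxx !addn0 addn1.
have -> : u ++ c :: L = rcons u c ++ L by rewrite cat_rcons.
rewrite -(size_rcons u c) IHL -cats1 !count_cat /=.
by case: c; rewrite /= ?addn0 ?addn1; case: (A _).
Qed.

Lemma psE L A : ps L A = ps_from 0 0 A L.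
Proof. exact: (ps_from_rank A [::] L). Qed.

Lemma ps_from_negb a b A L :
  ps_from a b A (map negb L) = map negb (ps_from b a A L).
Proof.
elim: L a b => [|[] L IHL] a b //=; rewrite IHL map_cat.
  by case: (A _).
by case: (A _).
Qed.

Lemma mch_P6 n L : mch n P6 (map negb L) = mch n P1 L.
Proof.
apply: eq_count => j; rewrite !psE ps_from_negb.
by rewrite /= -[P6]/(map negb P1) (inj_eq (inj_map negb_inj)).
Qed.

(* EENN appears at j iff more than j letters E precede the j-th N. *)
Fixpoint late_N (j a b : nat) (L : seq step) : bool :=
  if L is c :: L' then
    if c then late_N j a.+1 b L'
    else if b.+1 == j then (j < a)%N else late_N j a b.+1 L'
  else false.

(** The E's to come have rank above j + 1 and the N's rank above j, so only the N of rank j + 1 can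
    survive. *)
Lemma ps_from_E_done j a b L : (j < a)%N -> (j <= b)%N ->
  ps_from a b (pred2 j j.+1) L =
  if (b == j) && (N \in L) then [:: N] else [::].
Proof.
elim: L a b => [|[] L IHL] a b ja jb /=; first by rewrite andbF.
  have -> : (a.+1 == j) || (a.+1 == j.+1) = false by lia.
  by rewrite IHL//; lia.
rewrite IHL ?(leqW jb)// in_cons /= andbT.
have -> : (b.+1 == j) = false by lia.
by rewrite eqSS cats0.
Qed.

(* The number of indices j, j+1 that are at most a, i.e. of kept E's among the
   first a. *)
Definition nE (j a : nat) : nat := ((j <= a) + (j < a))%N.

Lemma nseq_nE j a :
  nseq (nE j a) E ++ (if pred2 j j.+1 a.+1 then [:: E] else [::]) =
  nseq (nE j a.+1) E.
Proof.
have -> : nE j a.+1 = (nE j a + pred2 j j.+1 a.+1)%N by rewrite /nE /=; lia.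
by rewrite nseqD; case: (pred2 _ _ _).
Qed.

(** While fewer than j N's are read, only E's have been kept, [nE j a] of them. The j-th N decides:
    the result is EENN iff both kept E's precede it. *)
Lemma late_NE j a b L n : (b < j)%N -> (j < n)%N ->
  (a + count_mem E L = n)%N -> (b + count_mem N L = n)%N ->
  (nseq (nE j a) E ++ ps_from a b (pred2 j j.+1) L == P1) = late_N j a b L.
Proof.
elim: L a b => [|[] L IHL] a b bj jn; first by rewrite /=; lia.
  rewrite [count_mem _ _]/= => ha; rewrite [count_mem _ _]/= => hb.
  rewrite [late_N _ _ _ _]/= -(IHL a.+1 b)// ?addSnnS//.
  by rewrite -nseq_nE -catA.
rewrite [count_mem _ _]/= => ha; rewrite [count_mem _ _]/= => hb.
rewrite [late_N _ _ _ _]/= [ps_from _ _ _ _]/=.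
case: (b.+1 =P j) => [bjE|nbj].
  (* Since j < n, the N of rank j + 1 is still to come. *)
  have : (0 < count_mem N L)%N.
    by move: jn; rewrite -hb addnA addn1 bjE -[X in (X < _)%N]addn0 ltn_add2l.
  rewrite -has_count has_pred1 => NL.
  rewrite /= /nE; case: (ltngtP j a) => [ja|ja|ja]//=.
  by rewrite ps_from_E_done ?bjE// NL eqxx.
have -> : (b.+1 == j.+1) = false by lia.
by rewrite -(IHL a b.+1)// ?addSnnS//; lia.
Qed.

(** After the N of rank j, n - a E's and n - j N's remain, so j < a means that fewer E's than N's
    remain. *)
Lemma count_late_N a b L n :
  (a + count_mem E L = n)%N -> (b + count_mem N L = n)%N ->
  count (fun j => late_N j a b L) (index_iota b.+1 n) = high_N L.
Proof.
elim: L a b => [|[] L IHL] a b; rewrite [count_mem E _]/= [count_mem N _]/=.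
- by move=> _ _; rewrite count_pred0.
- by move=> ha hb; apply: (IHL a.+1 b) => //; rewrite addSnnS.
move=> ha hb /=.
have hb' : (b.+1 + count_mem N L)%N = n by rewrite addSnnS.
have IH := IHL a b.+1 ha hb'.
(* The N of rank n lies outside the range of j, and [high_N] does not count it either, as no N
   follows it. *)
have [hn|hn] := leqP n b.+1.
  move: IH; rewrite /index_iota; have -> : (n - b.+1 = 0)%N by lia.
  have -> : (n - b.+2 = 0)%N by lia.
  by move=> /= <-; lia.
rewrite /index_iota (_ : n - b.+1 = (n - b.+2).+1)%N; last by lia.
rewrite /= eqxx -IH; congr (_ + _)%N; first by lia.
apply: eq_in_count => j; rewrite mem_iota => hj.
by case: eqP => //; lia.
Qed.

Lemma mch_P1 n L : count_mem E L = n -> count_mem N L = n ->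
  mch n P1 L = high_N L.
Proof.
move=> hE hN; rewrite -(@count_late_N 0 0 L n)//.
apply: eq_in_count => j; rewrite mem_index_iota => /andP[j0 jn].
by rewrite psE -(@late_NE j 0 0 L n)// /nE leqNgt j0.
Qed.

(** * Weighted sums over words and their recurrence on the first letter *)

Lemma big_tuple_cons (V : nmodType) m (P : pred (seq bool)) (G : seq bool -> V) :
  \sum_(L : m.+1.-tuple bool | P L) G L =
  \sum_(L : m.-tuple bool | P (true :: L)) G (true :: L) +
  \sum_(L : m.-tuple bool | P (false :: L)) G (false :: L).
Proof.
rewrite (reindex (fun p : bool * m.-tuple bool => [tuple of p.1 :: p.2])) /=.
  rewrite -(pair_big_dep xpredT (fun c (L : m.-tuple bool) => P (c :: L))
                                (fun c L => G (c :: L))) /=.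
  by rewrite big_bool.
exists (fun L => (thead L, [tuple of behead L])) => [[c L] _|L _] /=.
  by rewrite theadE; congr pair; apply: val_inj.
by rewrite [RHS]tuple_eta; apply: val_inj.
Qed.

Section WordSeries.
Variables (R : comNzRingType) (x : R).
Local Notation t := (fpsX R).

(** The length [m] is kept apart from e + n so that the first letter splits off without a cast. *)
Definition word_sum m e n : R :=
  \sum_(L : m.-tuple step | (count_mem E L == e) && (count_mem N L == n))
    x ^+ high_N L.

Lemma word_sum0 : word_sum 0 0 0 = 1.
Proof.
rewrite /word_sum (big_pred1 [tuple]) ?expr0// => L.
by rewrite [L]tuple0.
Qed.

Lemma word_sumS m e n : word_sum m.+1 e n =
  (if e is e'.+1 then word_sum m e' n else 0) +
  (if n is n'.+1 then x ^+ (e < n')%N * word_sum m e n' else 0).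
Proof.
rewrite /word_sum (@big_tuple_cons _ m
  (fun L => (count_mem E L == e) && (count_mem N L == n))
  (fun L => x ^+ high_N L)) /=.
congr (_ + _).
  by case: e => [|e]; [rewrite big_pred0 | apply: eq_bigl].
case: n => [|n]; first by rewrite big_pred0// => L; rewrite andbF.
rewrite mulr_sumr; apply: eq_big => [L|L /andP[/eqP hE /eqP hN]] //.
by rewrite exprD; congr (x ^+ _ * _); rewrite -hE -[n]/(n.+1.-1) -hN.
Qed.

(* First-passage decomposition: a word from height k > 0 descends k times
   through excursions above the axis, a word from height - k climbs k times. *)
Definition word_coef (A B f : fps R) e n : R :=
  if (e < n)%N then x ^+ (n - e).-1 * (A ^+ (n - e) * f) e
  else (B ^+ (e - n) * f) n.

Variables A B f : fps R.
Hypotheses (hA : A = 1 + fpsC x * t * A ^+ 2) (hB : B = 1 + t * B ^+ 2).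
Hypothesis hf : f = 1 + t * ((A + B) * f).

Let f0 : f 0%N = 1. Proof. by rewrite hf fpsDE coef_fpsXM addr0. Qed.

(** One factor A is expanded by [hA]: the term in A^k corresponds to a first letter N, the term in
    A^(k+2) to a first letter E. *)
Let coefA k e : (A ^+ k.+1 * f) e =
  (A ^+ k * f) e + x * (if e is e'.+1 then (A ^+ k.+2 * f) e' else 0).
Proof.
have -> : A ^+ k.+1 * f = A ^+ k * f + fpsC x * (t * (A ^+ k.+2 * f)).
  by rewrite exprSr {2}hA !exprSr; ring.
by rewrite fpsDE coef_fpsCM coef_fpsXM.
Qed.

Let coefB k n : (B ^+ k.+1 * f) n =
  (B ^+ k * f) n + (if n is n'.+1 then (B ^+ k.+2 * f) n' else 0).
Proof.
have -> : B ^+ k.+1 * f = B ^+ k * f + t * (B ^+ k.+2 * f).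
  by rewrite exprSr {2}hB !exprSr; ring.
by rewrite fpsDE coef_fpsXM.
Qed.

Local Notation K := (word_coef A B f).

Lemma word_coefS e n : (0 < e + n)%N -> K e n =
  (if e is e'.+1 then K e' n else 0) +
  (if n is n'.+1 then x ^+ (e < n')%N * K e n' else 0).
Proof.
(* Of the k + 1 descents to the axis, the last one lands at height 0 and carries no x. *)
have Kgt k e' : K e' (e' + k).+1 = x ^+ k * (A ^+ k.+1 * f) e'.
  by rewrite /word_coef ltnS leq_addr -addnS addKn.
have Kle k n' : K (n' + k) n' = (B ^+ k * f) n'.
  by rewrite /word_coef ltnNge leq_addr addKn.
case: (ltngtP e n) => [en|ne|->].
- have [k ->] : exists k, n = (e + k).+1.
    by exists (n - e.+1)%N; rewrite -addSn subnKC.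
  move=> _; rewrite Kgt coefA mulrDr addrC mulrA -exprSr; congr (_ + _).
    case: e {en} => [|e]; first by rewrite mulr0.
    by rewrite addSnnS Kgt.
  (* For k = 0 the initial N reaches the axis: it has weight 1, and the other branch of [word_coef]
     takes over. *)
  case: k => [|k].
    by move: (Kle 0%N e); rewrite addn0 ltnn !expr0 !mul1r => ->.
  by rewrite addnS ltnS leq_addr Kgt mulrA exprS.
- have [k ->] : exists k, e = (n + k).+1.
    by exists (e - n.+1)%N; rewrite -addSn subnKC.
  move=> _; rewrite -addnS Kle coefB addnS Kle; congr (_ + _).
  case: n {ne} => [//|n]; rewrite (_ : (n.+1 + k).+1 = (n + k.+2))%N; last by lia.
  by rewrite Kle ltnNge leq_addr mul1r.
case: n => // n _.
move: (Kle 0%N n.+1) (Kgt 0%N n) (Kle 1%N n).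
rewrite !addn0 addn1 => -> -> ->.
rewrite (_ : (n.+1 < n)%N = false) ?(expr0, expr1, mul1r); last by lia.
by rewrite {1}hf fpsDE coef_fpsXM add0r mulrDl.
Qed.

Lemma word_sumE m e n : (e + n = m)%N -> word_sum m e n = K e n.
Proof.
elim: m e n => [|m IHm] e n enm.
  have [-> ->] : e = 0%N /\ n = 0%N by lia.
  by rewrite word_sum0 /word_coef ltnn mul1r f0.
rewrite word_sumS word_coefS ?enm//; congr (_ + _).
  by case: e enm => // e enm; rewrite IHm//; lia.
by case: n enm => // n enm; rewrite IHm//; lia.
Qed.

Lemma word_sum_balanced n : word_sum (n + n) n n = f n.
Proof. by rewrite word_sumE// /word_coef ltnn subnn mul1r. Qed.

End WordSeries.

(** * The two generating functions and their closed forms *)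

Lemma F_P6 : F P6 = F P1.
Proof.
rewrite /F; congr (_ + _); apply/fpsP => n /=; case: ifP => // _.
pose swap (L : (n + n).-tuple step) : (n + n).-tuple step := map_tuple negb L.
have swapK : involutive swap.
  by move=> L; apply: val_inj; rewrite /= (mapK negbK).
rewrite (reindex_inj (inv_inj swapK)) /=.
have count_swap c (L : seq step) : count_mem c (map negb L) = count_mem (~~ c) L.
  by rewrite count_map; apply: eq_count => d /=; rewrite -(inj_eq negb_inj) negbK.
apply: eq_big => [L|L _]; last by rewrite mch_P6.
by rewrite !inE /= !count_swap andbC.
Qed.

(** The equation characterizes f = 1 / (1 - t A - t B) without inverses. *)
Lemma F_P1E (f : fps {poly rat}) :
  f = 1 + fpsX _ * ((catalan_fps 'X + catalan_fps 1) * f) -> F P1 = f.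
Proof.
move=> hf; have hA := catalan_fpsE ('X : {poly rat}).
have hB := catalan_fpsE (1 : {poly rat}); rewrite fpsC1 mul1r in hB.
apply/fpsP => n; rewrite -(word_sum_balanced hA hB hf).
rewrite /F fpsDE /= /word_sum; case: n => [|n] /=.
  rewrite addr0 (big_pred1 [tuple]) ?expr0// => L.
  by rewrite [L]tuple0.
rewrite add0r; apply: eq_big => [L|L]; first by rewrite inE.
by rewrite inE => /andP[/eqP hE /eqP hN]; rewrite mch_P1.
Qed.

Theorem mainTheorem4 :
  let x : fps {poly rat} := fpsC 'X in
  let t : fps {poly rat} := fpsX {poly rat} in
  let C := @catalan_gf {poly rat} in
  [/\ (F P1)%:F = (F P6)%:F,
      (F P6)%:F = (C t - 1) / (t%:F * (1 - (C (x * t) - 1) * (C t - 1))),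
      (C t - 1) / (t%:F * (1 - (C (x * t) - 1) * (C t - 1)))
      = (2%:R * x)%:F
        / (x * fps_sqrt (1 - 4%:R * t) + fps_sqrt (1 - 4%:R * (x * t)) + x - 1)%:F
    & forall c : {poly rat}, c != 0 ->
        C (fpsC c * t) = (FPS (fun n => (catalan n)%:R * c ^+ n))%:F].
Proof.
move=> x t C.
have n2 : (2%:R : {poly rat}) != 0 by rewrite -polyC_natr polyC_eq0.
have X0 : ('X : {poly rat}) != 0 by rewrite polyX_eq0.
set A := catalan_fps ('X : {poly rat}); set B := catalan_fps (1 : {poly rat}).
have hA : A = 1 + x * t * A ^+ 2 := catalan_fpsE _.
have hB : B = 1 + t * B ^+ 2 by rewrite {1}/B catalan_fpsE fpsC1 mul1r.
have CA : C (x * t) = A%:F by exact: catalan_gfE.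
have CB : C t = B%:F.
  by rewrite -(catalan_gfE n2 (oner_neq0 _)) fpsC1 mul1r.
have [f hf] := fps_geom_exists (A + B); have Ff := F_P1E hf.
(* As f D = 1, each closed form follows once its denominator is a nonzero multiple of D: t B^2 D for
   the first, 2 x D for the second. *)
pose D := 1 - t * A - t * B.
have fD : f * D = 1.
  by rewrite /D -[1 in RHS](addrK (t * ((A + B) * f))) -hf; ring.
have D0 : D != 0.
  by apply/eqP => D0; move/eqP: fD; rewrite D0 mulr0 eq_sym oner_eq0.
have t0 : t != 0.
  by apply/eqP => /(congr1 (fun g : fps {poly rat} => g 1%N))/eqP; rewrite oner_eq0.
have x0 : 2%:R * x != 0.
  apply/eqP => /(congr1 (fun g : fps {poly rat} => g 0%N)).
  rewrite mulr_natl mulr2n fpsDE /= -mulr2n -mulr_natl => /eqP.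
  by rewrite mulf_eq0 (negPf n2) (negPf X0).
have B0 : B != 0.
  apply/eqP => /(congr1 (fun g : fps {poly rat} => g 0%N))/eqP.
  by rewrite catalan_fps0 oner_eq0.
have denE : 1 - (A - 1) * (B - 1) = B ^+ 2 * D.
  have tB2 : t * B ^+ 2 = B - 1 by rewrite [in RHS]hB addrC addKr.
  transitivity (B ^+ 2 - A * (t * B ^+ 2) - B * (t * B ^+ 2)).
    by rewrite tB2; ring.
  by rewrite /D; ring.
have eq1 : (C t - 1) / (t%:F * (1 - (C (x * t) - 1) * (C t - 1))) = f%:F.
  rewrite CA CB -!tofrac1 -!tofracB -tofracM -tofracB -tofracM denE.
  have -> : B - 1 = f * (t * (B ^+ 2 * D)).
    by rewrite {1}hB -[t * _ in LHS]mul1r -fD; ring.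
  by rewrite rmorphM mulfK// tofrac_eq0 !mulf_neq0// expf_neq0.
have eq2 : (2%:R * x)%:F
    / (x * fps_sqrt (1 - 4%:R * t) + fps_sqrt (1 - 4%:R * (x * t)) + x - 1)%:F = f%:F.
  rewrite (fps_sqrt_catalan 'X n2).
  have := fps_sqrt_catalan 1 n2; rewrite fpsC1 mul1r => ->.
  have -> : x * (1 - 2%:R * t * B) + (1 - 2%:R * (x * t) * A) + x - 1 =
            2%:R * x * D by rewrite /D; ring.
  have {1}-> : 2%:R * x = f * (2%:R * x * D) by rewrite -[LHS]mul1r -fD; ring.
  by rewrite rmorphM mulfK// tofrac_eq0 mulf_neq0.
split.
- by rewrite F_P6.
- by rewrite F_P6 Ff eq1.
- by rewrite eq1 eq2.
by move=> c c0; rewrite /C catalan_gfE.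
Qed.
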